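(* Let $(P_n(x))_{n\in\mathbb{N}_0}\subseteq\mathbb{R}[x]$ be given by $P_0(x)=1$, $P_1(x)=x$, $xP_n(x)=a_nP_{n+1}(x)+c_nP_{n-1}(x)$ $(n\in\mathbb{N})$ with $a_n=1-c_n$ and, for all $n\in\mathbb{N}$, $$c_{2n-1}=\frac{6n+4}{9n+9},\qquad c_{2n}=\frac{n+1}{3n+5}.$$ Then $(P_n(x))_{n\in\mathbb{N}_0}$ satisfies nonnegative linearization of products, i.e., $(P_n(x))_{n\in\mathbb{N}_0}$ induces a polynomial hypergroup on $\mathbb{N}_0$. The Haar function $h:\mathbb{N}_0\rightarrow[1,\infty)$ satisfies $$h(2n-1)=\frac{9}{5}\left(\frac{n}{2}+\frac{1}{2}\right)^2\qquad\text{and}\qquad h(2n)=\frac{9}{5}\left(\frac{n}{2}+\frac{5}{6}\right)^2$$ for every $n\in\mathbb{N}$. In particular, one has $h(1)=9/5<2$.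
   Context: $\mathbb{N}=\{1,2,3,\ldots\}$ and $\mathbb{N}_0=\mathbb{N}\cup\{0\}$. A sequence given by such a recurrence with $(c_n)_{n\in\mathbb{N}}\subseteq(0,1)$ satisfies $\deg P_n=n$ and $P_n(1)=1$ for all $n$, and it is orthogonal with respect to a unique probability Borel measure $\mu$ on $\mathbb{R}$, meaning that $\int_{\mathbb{R}}P_m(x)P_n(x)\,\mathrm{d}\mu(x)\neq 0\Leftrightarrow m=n$. Nonnegative linearization of products means that in the (unique) expansions $P_m(x)P_n(x)=\sum_{k=0}^{m+n}g(m,n;k)P_k(x)$ all coefficients $g(m,n;k)$ $(m,n,k\in\mathbb{N}_0)$ are nonnegative; in this case, the convolution $(m,n)\mapsto\sum_{k=|m-n|}^{m+n}g(m,n;k)\delta_k$ induces a commutative discrete hypergroup on $\mathbb{N}_0$ (with the identity as involution and unit element $0$), called a polynomial hypergroup. The Haar function is $h(n):=1/g(n,n;0)=1/\int_{\mathbb{R}}P_n^2(x)\,\mathrm{d}\mu(x)$; equivalently, $h(0)=1$ and $h(n)=\prod_{k=1}^n a_{k-1}/c_k$ for $n\in\mathbb{N}$, where $a_0:=1$. *)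

(* Defs.v *)
From HB Require Import structures.
From mathcomp Require Import all_boot all_order all_algebra.
From mathcomp Require Import finmap reals.
From mathcomp Require Import monalg.
Set Implicit Arguments.
Unset Strict Implicit.
Unset Printing Implicit Defensive.
Import Order.TTheory GRing.Theory Num.Theory.
Local Open Scope ring_scope.

(* The constraint on k > m + n fixes the unused values, so that g is
   determined everywhere as soon as (P_n) is a basis with deg P_n = n. *)
Definition linearization_coefficients (R : realType) (P : nat -> {poly R})
    (g : nat -> nat -> nat -> R) : Prop :=
  forall m n : nat,
    P m * P n = \sum_(0 <= k < (m + n).+1) g m n k *: P k
    /\ (forall k : nat, (m + n < k)%N -> g m n k = 0).

Definition nonnegative_linearization (R : realType)
    (g : nat -> nat -> nat -> R) : Prop :=
  forall m n k : nat, 0 <= g m n k.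

(* A finitely supported (signed) measure on a discrete space K is an element
   of {malg R[K]}; << k >> is the Dirac measure at k and f@_k = f({k}). *)
Definition is_probability (R : realType) (K : choiceType)
    (f : {malg R[K]}) : Prop :=
  (forall z : K, 0 <= f@_z) /\ \sum_(z <- msupp f) f@_z = 1.

(* On a discrete space the topological axioms of a hypergroup reduce to the
   finiteness of the supports, which is built into {malg R[K]}. *)
Record commutative_discrete_hypergroup (R : realType) (K : choiceType)
    (conv : K -> K -> {malg R[K]}) (inv : K -> K) (e : K) : Prop :=
  CommutativeDiscreteHypergroup {
    hypergroup_prob : forall x y : K, is_probability (conv x y);
    hypergroup_assoc : forall x y z : K,
      \sum_(w <- msupp (conv x y)) (conv x y)@_w *: conv w z =
      \sum_(w <- msupp (conv y z)) (conv y z)@_w *: conv x w;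
    hypergroup_invK : forall x : K, inv (inv x) = x;
    hypergroup_inv : forall x y z : K,
      (conv (inv y) (inv x))@_(inv z) = (conv x y)@_z;
    hypergroup_unitl : forall x : K, conv e x = << x >>;
    hypergroup_unitr : forall x : K, conv x e = << x >>;
    hypergroup_supp_unit : forall x y : K,
      e \in msupp (conv x (inv y)) <-> x = y;
    hypergroup_comm : forall x y : K, conv x y = conv y x
  }.

Definition convolution (R : realType) (g : nat -> nat -> nat -> R)
    (m n : nat) : {malg R[nat]} :=
  \sum_(`|m%:Z - n%:Z|%N <= k < (m + n).+1) << g m n k *g k >>.

Definition induces_polynomial_hypergroup (R : realType)
    (g : nat -> nat -> nat -> R) : Prop :=
  commutative_discrete_hypergroup (convolution g) id 0%N.

Definition haar (R : realType) (g : nat -> nat -> nat -> R) (n : nat) : R :=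
  1 / g n n 0%N.

(* Main.v *)
(** Put [E_i = (3i+5) P_(2i)] and [O_i = (3i+6) P_(2i+1)].  In this
    normalisation the recurrence has period two:
    [3x O_i = E_(i+1) + 2 E_i] and [3x E_(i+1) = 2 O_(i+1) + O_i].
    Hence, with [t = (9x^2-5)/2], both sequences satisfy the Chebyshev
    recurrence [t f_(i+1) = f_(i+2) + f_i], which yields closed product
    formulas with coefficients 2, 3 and 4 only, for instance
    [O_n O_(d+n) = 2 E_(d+2n+1) + 3 sum_(j<n) E_(d+2+2j) + 4 E_d].
    The last term carries the lowest index [|m-n|]; for [m = n] it is
    [4 E_0 = 20 P_0], which gives the Haar function as the squared
    normalisation divided by 20.  The hypergroup axioms only use that the
    nonnegative coefficients are supported on [|m-n|..m+n] and that [P_0]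
    occurs in [P_m P_n] exactly when [m = n]. *)
Require Import Defs.
From mathcomp Require Import all_boot all_order all_algebra.
From mathcomp Require Import finmap boolp reals monalg ring lra zify.
Import Order.TTheory GRing.Theory Num.Theory.
Local Open Scope ring_scope.

(** * Bases with one polynomial of each degree, and nonnegative combinations *)

Section PolynomialBasis.
Context {R : realType} {P : nat -> {poly R}}.
Hypothesis size_P : forall n, size (P n) = n.+1.

(** Only [P N] reaches degree [N], so the coefficient there forces [d N = 0]; then induct. *)
Lemma basis_free (N : nat) (d : nat -> R) :
  \sum_(0 <= k < N) d k *: P k = 0 -> forall k, (k < N)%N -> d k = 0.
Proof.
elim: N => // N IH; rewrite big_nat_recr //= => sum0 k.
have dN : d N = 0.
  have := congr1 (fun p : {poly R} => p`_N) sum0.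
  rewrite coefD coef0 coefZ coef_sum big_nat big1 => [|i /andP[_ ltiN]]; last first.
    by rewrite coefZ nth_default ?mulr0 // size_P.
  have := lead_coef_eq0 (P N); rewrite lead_coefE size_P /= => lcP /eqP.
  by rewrite add0r mulf_eq0 lcP -size_poly_eq0 size_P orbF => /eqP.
rewrite ltnS leq_eqVlt => /predU1P[-> //|]; apply: IH.
by move: sum0; rewrite dN scale0r addr0.
Qed.

Lemma basis_coef_inj (N : nat) (d e : nat -> R) :
  \sum_(0 <= k < N) d k *: P k = \sum_(0 <= k < N) e k *: P k ->
  forall k, (k < N)%N -> d k = e k.
Proof.
move=> eq_de k ltkN; apply/eqP; rewrite -subr_eq0; apply/eqP.
apply: (basis_free N (fun k => d k - e k)) ltkN.
under eq_bigr do rewrite scalerBl.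
by rewrite big_split /= sumrN eq_de subrr.
Qed.

(** The sum starts at 0 and [d] vanishes off the band, so [d] can serve directly as a row of
    linearization coefficients. *)
Definition nonneg_span (lo hi : nat) (p : {poly R}) : Prop :=
  exists d : nat -> R, [/\ forall k, 0 <= d k,
    forall k, ~~ (lo <= k <= hi)%N -> d k = 0
    & p = \sum_(0 <= k < hi.+1) d k *: P k].

Lemma nonneg_span0 lo hi : nonneg_span lo hi 0.
Proof.
by exists (fun=> 0); split=> //; rewrite big1 // => i _; rewrite scale0r.
Qed.

Lemma nonneg_spanD lo hi p q :
  nonneg_span lo hi p -> nonneg_span lo hi q -> nonneg_span lo hi (p + q).
Proof.
move=> [d [d0 dz ->]] [e [e0 ez ->]]; exists (fun k => d k + e k).
split=> [k|k lek|]; first by rewrite addr_ge0.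
- by rewrite dz // ez // addr0.
- by rewrite -big_split; apply: eq_bigr => i _; rewrite scalerDl.
Qed.

Lemma nonneg_spanZ lo hi (x : R) p :
  0 <= x -> nonneg_span lo hi p -> nonneg_span lo hi (x *: p).
Proof.
move=> x0 [d [d0 dz ->]]; exists (fun k => x * d k).
split=> [k|k lek|]; first by rewrite mulr_ge0.
- by rewrite dz // mulr0.
- by rewrite scaler_sumr; apply: eq_bigr => i _; rewrite scalerA.
Qed.

Lemma nonneg_span_sum lo hi (n : nat) (F : nat -> {poly R}) :
  (forall j, (j < n)%N -> nonneg_span lo hi (F j)) ->
  nonneg_span lo hi (\sum_(0 <= j < n) F j).
Proof.
move=> sF; rewrite big_nat; elim/big_rec: _ => [|j p jn sp].
  exact: nonneg_span0.
by apply: nonneg_spanD => //; apply: sF.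
Qed.

Lemma sum_delta_basis (N k : nat) (x : R) : (k < N)%N ->
  \sum_(0 <= i < N) (x *+ (i == k)) *: P i = x *: P k.
Proof.
move=> kN; rewrite (bigD1_seq k) ?mem_index_iota ?iota_uniq //= eqxx mulr1n.
by rewrite big1 ?addr0 // => i /negPf->; rewrite scale0r.
Qed.

Lemma nonneg_span_basis lo hi k :
  (lo <= k <= hi)%N -> nonneg_span lo hi (P k).
Proof.
move=> lek; exists (fun i => 1 *+ (i == k)); split=> [i|i|].
- by case: (i == k).
- by case: eqP => // ->; rewrite lek.
- by rewrite sum_delta_basis ?scale1r // ltnS; case/andP: lek.
Qed.

End PolynomialBasis.

(** * From nonnegative linearization to a hypergroup *)

Section PolynomialHypergroup.
Context {R : realType} {P : nat -> {poly R}} {g : nat -> nat -> nat -> R}.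
Hypothesis size_P : forall n, size (P n) = n.+1.
Hypothesis P_0 : P 0%N = 1.
Hypothesis P_at1 : forall n, (P n).[1] = 1.
Hypothesis lin_g : linearization_coefficients P g.

(** Padding with zeros lets products of different degrees be expanded over one common range. *)
Lemma linearizationE (N m n : nat) : (m + n < N)%N ->
  P m * P n = \sum_(0 <= k < N) g m n k *: P k.
Proof.
move=> mnN; have [-> gz] := lin_g m n.
rewrite [RHS](big_cat_nat (leq0n _) mnN) //= [X in _ + X]big_nat.
by rewrite [X in _ + X]big1 ?addr0 // => k /andP[mnk _]; rewrite gz ?scale0r.
Qed.

Lemma linearization_unique (d : nat -> R) (m n : nat) :
  (forall k, (m + n < k)%N -> d k = 0) ->
  P m * P n = \sum_(0 <= k < (m + n).+1) d k *: P k -> g m n =1 d.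
Proof.
move=> dz PE k; case: (leqP k (m + n)) => [lek|ltk].
  apply: (basis_coef_inj size_P (m + n).+1); rewrite ?ltnS //.
  by rewrite -PE -linearizationE.
by rewrite dz //; apply: (proj2 (lin_g m n)).
Qed.

Lemma linearizationC m n : g m n =1 g n m.
Proof.
apply: linearization_unique => [k|]; first by rewrite addnC; apply: (lin_g n m).2.
by rewrite addnC mulrC -linearizationE.
Qed.

Lemma linearization0 n k : g 0 n k = (n == k)%:R.
Proof.
rewrite (linearization_unique (fun k => 1 *+ (k == n))) => [|i|].
- by rewrite eq_sym.
- by rewrite add0n; case: eqP => // ->; rewrite ltnn.
- by rewrite sum_delta_basis // scale1r P_0 mul1r.
Qed.

Hypothesis g_ge0 : nonnegative_linearization g.
Hypothesis g_band : forall m n k, (k < m - n)%N -> g m n k = 0.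
Hypothesis g_unit : forall m n, (g m n 0 != 0) = (m == n).

Lemma convolution_coef m n k : (convolution g m n)@_k = g m n k.
Proof.
rewrite /convolution raddf_sum /=; under eq_bigr do rewrite mcoeffU.
set lo := `|m%:Z - n%:Z|%N; case: (boolP (lo <= k < (m + n).+1)%N) => [lek|].
  rewrite (bigD1_seq k) ?mem_index_iota ?iota_uniq //= eqxx mulr1n.
  by rewrite big1 ?addr0 // => i /negPf->.
rewrite negb_and -ltnNge -leqNgt => out.
rewrite big_nat big1 => [|i ilo]; last first.
  by case: eqP => // ik; move: ilo out; rewrite -ik; lia.
(* Below [|m - n|], [g_band] covers [n <= m]; the other case follows by symmetry. *)
case/orP: out => [klo|mnk]; last by rewrite (lin_g m n).2.
case: (leqP n m) => nm; first by rewrite g_band //; lia.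
by rewrite linearizationC g_band //; lia.
Qed.

(** Indices outside the support contribute zero, so the support can be traded for an interval that
    does not depend on [g]. *)
Lemma sum_convolution (V : lmodType R) (F : nat -> V) m n N :
  (m + n < N)%N ->
  \sum_(w <- msupp (convolution g m n)) (convolution g m n)@_w *: F w =
  \sum_(0 <= w < N) g m n w *: F w.
Proof.
move=> mnN; set f := convolution g m n.
rewrite [RHS](bigID (fun w => w \in msupp f)) /= [X in _ + X]big1 ?addr0; last first.
  by move=> w /mcoeff_outdom; rewrite convolution_coef => ->; rewrite scale0r.
rewrite -[RHS]big_filter; under [RHS]eq_bigr do rewrite -convolution_coef.
apply: perm_big; apply: uniq_perm; rewrite ?filter_uniq ?iota_uniq ?fset_uniq //.
move=> w; rewrite mem_filter mem_index_iota /=; case: msuppP => //=.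
rewrite -mcoeff_neq0 convolution_coef; case: ltnP => // Nw.
by rewrite (lin_g m n).2 ?eqxx //; apply: leq_trans Nw.
Qed.

(* Both sides are the coefficients of [P x * P y * P z] in the basis [P]. *)
Lemma convolutionA x y z :
  \sum_(w <- msupp (convolution g x y)) (convolution g x y)@_w *: convolution g w z =
  \sum_(w <- msupp (convolution g y z)) (convolution g y z)@_w *: convolution g x w.
Proof.
pose N := (x + y + z).+1.
rewrite !(sum_convolution _ _ _ _ N) ?ltnS ?leq_addr -?addnA ?leq_addl //.
apply/malgP => k; rewrite !raddf_sum /=.
under eq_bigr do rewrite mcoeffZ convolution_coef.
under [RHS]eq_bigr do rewrite mcoeffZ convolution_coef.
(* Large enough to exceed [k] and the degree of every product that occurs below. *)
pose M := (N + N + k).+1.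
apply: (basis_coef_inj size_P M
  (fun k => \sum_(0 <= w < N) g x y w * g w z k)
  (fun k => \sum_(0 <= w < N) g y z w * g x w k)); last by rewrite /M; lia.
under eq_bigr do rewrite scaler_suml.
under [RHS]eq_bigr do rewrite scaler_suml.
rewrite exchange_big_nat [RHS]exchange_big_nat /=.
transitivity (P x * P y * P z).
  rewrite (linearizationE N x y) /N ?mulr_suml; last by lia.
  rewrite !big_nat; apply: eq_bigr => w /andP[_ wN].
  rewrite -scalerAl (linearizationE M) ?scaler_sumr /M /N; last by lia.
  by apply: eq_bigr => i _; rewrite scalerA.
rewrite -mulrA (linearizationE N y z) /N ?mulr_sumr; last by lia.
rewrite !big_nat; apply: eq_bigr => w /andP[_ wN].
rewrite -scalerAr (linearizationE M) ?scaler_sumr /M /N; last by lia.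
by apply: eq_bigr => i _; rewrite scalerA.
Qed.

Lemma linearization_hypergroup : induces_polynomial_hypergroup g.
Proof.
have convC m n : convolution g m n = convolution g n m.
  by apply/malgP => k; rewrite !convolution_coef linearizationC.
have conv0 n : convolution g 0 n = << n >>.
  by apply/malgP => k; rewrite convolution_coef linearization0 mcoeffU.
split=> //.
- move=> m n; split=> [k|]; first by rewrite convolution_coef.
  (* The total mass is the linearization formula evaluated at 1, where every [P n] equals 1. *)
  have := sum_convolution R^o (fun=> 1) m n _ (leqnn _).
  under eq_bigr do rewrite [_ *: _]mulr1.
  move->; have := congr1 (horner^~ 1) (linearizationE _ m n (leqnn _)).
  rewrite /= hornerM !P_at1 mulr1 horner_sum => sum1; rewrite [RHS]sum1.
  by apply: eq_bigr => k _; rewrite hornerZ P_at1 mulr1 [LHS]mulr1.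
- exact: convolutionA.
- by move=> m n k; rewrite convC.
- by move=> n; rewrite convC.
- move=> m n; rewrite -mcoeff_neq0 convolution_coef g_unit.
  by split=> [/eqP|->].
Qed.
End PolynomialHypergroup.

(** * Degree and value at 1 from the recurrence *)

Section ThreeTermRecurrence.
Context {R : realType} {a c : nat -> R} {P : nat -> {poly R}}.
Hypothesis a_def : forall n, (1 <= n)%N -> a n = 1 - c n.
Hypothesis a_neq0 : forall n, (1 <= n)%N -> a n != 0.
Hypothesis P_0 : P 0%N = 1.
Hypothesis P_1 : P 1%N = 'X.
Hypothesis P_rec : forall n, (1 <= n)%N ->
  'X * P n = a n *: P n.+1 + c n *: P n.-1.

Lemma recurrence_step n :
  P n.+2 = (a n.+1)^-1 *: ('X * P n.+1 - c n.+1 *: P n).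
Proof. by rewrite P_rec // addrK scalerA mulVf ?scale1r // a_neq0. Qed.

Lemma recurrence_size n : size (P n) = n.+1.
Proof.
suff: size (P n) = n.+1 /\ size (P n.+1) = n.+2 by case.
elim: n => [|n [IH1 IH2]]; first by rewrite P_0 P_1 size_poly1 size_polyX.
split=> //; rewrite recurrence_step size_scale ?invr_eq0 ?a_neq0 //.
have sX : size ('X * P n.+1) = n.+3.
  by rewrite mulrC size_mulX ?IH2 // -size_poly_eq0 IH2.
by rewrite size_polyDl sX // size_polyN (leq_ltn_trans (size_scale_leq _ _)) // IH1.
Qed.

Lemma recurrence_at1 n : (P n).[1] = 1.
Proof.
suff: (P n).[1] = 1 /\ (P n.+1).[1] = 1 by case.
elim: n => [|n [IH1 IH2]]; first by rewrite P_0 P_1 hornerC hornerX.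
split=> //; rewrite recurrence_step !hornerE IH1 IH2 !mulr1.
by rewrite -a_def // mulVf // a_neq0.
Qed.

End ThreeTermRecurrence.

(** * Products of sequences with a common Chebyshev recurrence *)

(** Two-step induction on [n] at fixed index difference [d]. The step also uses the difference
    [d + 2], hence the quantification over [d]. The parameters [u] and [v] absorb the index shifts
    of the parity cases. *)
Lemma product_formula (A : comNzRingType) (t al ga be : A) (p e f : nat -> A)
    (u v : nat) :
  (forall n, t * p n.+1 = p n.+2 + p n) ->
  (forall n, t * e n.+1 = e n.+2 + e n) ->
  (forall d, p 0%N * e d = al * f (d + u)%N + be * f d) ->
  (forall d, p 1%N * e d.+1 =
     al * f (d + u + 2)%N + ga * f (d + v)%N + be * f d) ->
  forall n d, p n * e (d + n)%N =
    al * f (d + u + 2 * n)%N + ga * \sum_(0 <= j < n) f (d + v + 2 * j)%N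
    + be * f d.
Proof.
move=> p_rec e_rec base0 base1 n.
suff: forall d,
    (p n * e (d + n)%N = al * f (d + u + 2 * n)%N
       + ga * \sum_(0 <= j < n) f (d + v + 2 * j)%N + be * f d) /\
    (p n.+1 * e (d + n.+1)%N = al * f (d + u + 2 * n.+1)%N
       + ga * \sum_(0 <= j < n.+1) f (d + v + 2 * j)%N + be * f d).
  by move=> H d; case: (H d).
elim: n => [|n IH] d.
  by rewrite addn0 addn1 big_nil big_nat1 !addn0 mulr0 addr0 base0 base1.
split; first by case: (IH d).
have [_ IHd] := IH d; have [IHd2 IHd2'] := IH d.+2.
(* Expand [t * p n.+1 * e (d + n.+2)] by either recurrence and compare. In the result, the sums for
   [d + 2] and [d] combine so that the inner terms cancel. *)
have -> : p n.+2 * e (d + n.+2)%N =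
  p n.+1 * e (d.+2 + n.+1)%N + p n.+1 * e (d + n.+1)%N - p n * e (d.+2 + n)%N.
  have := e_rec (d + n.+1)%N; rewrite !addnS !addSn => /(canLR (addrK _))<-.
  by have := p_rec n => /(canLR (addrK _))<-; ring.
rewrite IHd IHd2 IHd2' !big_nat_recr //=.
have -> : (d.+2 + u + 2 * n.+1 = d + u + 2 * n.+2)%N by lia.
have -> : (d.+2 + u + 2 * n = d + u + 2 * n.+1)%N by lia.
have -> : (d.+2 + v + 2 * n = d + v + 2 * n.+1)%N by lia.
ring.
Qed.

(** Numerals are polynomials in the product formulas, which suits [ring]; this turns them into
    scalars. *)
Lemma natl_scale {R : realType} (k : nat) (x : R) (p : {poly R}) :
  k%:R * (x *: p) = (k%:R * x) *: p.
Proof. by rewrite mulr_natl -scaler_nat scalerA. Qed.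

Lemma natl_scale1 {R : realType} (k : nat) (p : {poly R}) :
  k%:R * p = (k%:R : R) *: p.
Proof. by rewrite -[p in LHS]scale1r natl_scale mulr1. Qed.

(** * Recurrence coefficients and the rescaled sequences *)

Section ProductFormulas.
Context {R : realType} {c a : nat -> R} {P : nat -> {poly R}}.
Hypothesis c_odd : forall n : nat, (1 <= n)%N ->
  c (2 * n - 1)%N = (6 * n%:R + 4) / (9 * n%:R + 9).
Hypothesis c_even : forall n : nat, (1 <= n)%N ->
  c (2 * n)%N = (n%:R + 1) / (3 * n%:R + 5).
Hypothesis a_def : forall n, (1 <= n)%N -> a n = 1 - c n.
Hypothesis P_0 : P 0%N = 1.
Hypothesis P_1 : P 1%N = 'X.
Hypothesis P_rec : forall n, (1 <= n)%N ->
  'X * P n = a n *: P n.+1 + c n *: P n.-1.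

Lemma c_oddS i : c (2 * i).+1 = (6 * i%:R + 10) / (9 * i%:R + 18).
Proof.
have -> : (2 * i).+1 = (2 * i.+1 - 1)%N by lia.
by rewrite c_odd // -natr1; congr (_ / _); ring.
Qed.

Lemma c_evenS i : c (2 * i).+2 = (i%:R + 2) / (3 * i%:R + 8).
Proof.
have -> : (2 * i).+2 = (2 * i.+1)%N by lia.
by rewrite c_even // -natr1; congr (_ / _); ring.
Qed.

Lemma a_oddS i : a (2 * i).+1 = (3 * i%:R + 8) / (9 * i%:R + 18).
Proof.
have i0 : 0 <= i%:R :> R by [].
by rewrite a_def // c_oddS; field; lra.
Qed.

Lemma a_evenS i : a (2 * i).+2 = (2 * i%:R + 6) / (3 * i%:R + 8).
Proof.
have i0 : 0 <= i%:R :> R by [].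
by rewrite a_def // c_evenS; field; lra.
Qed.

Lemma a_neq0 n : (1 <= n)%N -> a n != 0.
Proof.
case: n => // n _; have := odd_double_half n; case: (odd n) => <-.
  rewrite add1n -mul2n a_evenS; have i0 : 0 <= (n./2)%:R :> R by [].
  by apply: lt0r_neq0; apply: divr_gt0; lra.
rewrite add0n -mul2n a_oddS; have i0 : 0 <= (n./2)%:R :> R by [].
by apply: lt0r_neq0; apply: divr_gt0; lra.
Qed.

(* Up to the factor [20], the square of [weight n] is the Haar function at
   [n >= 1]; after this rescaling the recurrence is periodic of period two. *)
Definition weight (n : nat) : R := (3 * n./2 + 5 + odd n)%:R.
Definition scaled (n : nat) : {poly R} := weight n *: P n.
Definition evens (i : nat) : {poly R} := scaled (2 * i).
Definition odds (i : nat) : {poly R} := scaled (2 * i).+1.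

Lemma weight_even i : weight (2 * i) = 3 * i%:R + 5.
Proof.
have -> : weight (2 * i) = (3 * i + 5)%:R by congr _%:R; lia.
by rewrite natrD natrM.
Qed.

Lemma weight_odd i : weight (2 * i).+1 = 3 * i%:R + 6.
Proof.
have -> : weight (2 * i).+1 = (3 * i + 6)%:R by congr _%:R; lia.
by rewrite natrD natrM.
Qed.

Lemma mulX_scale n (x : R) : (1 <= n)%N ->
  3 * 'X * (x *: P n) = (3 * x * a n) *: P n.+1 + (3 * x * c n) *: P n.-1.
Proof.
by move=> n_gt0; rewrite -mulrA -scalerAr natl_scale P_rec // scalerDr !scalerA.
Qed.

Lemma mulX_odds i : 3 * 'X * odds i = evens i.+1 + 2 * evens i.
Proof.
have i0 : 0 <= i%:R :> R by [].
rewrite mulX_scale // /evens /scaled natl_scale weight_odd c_oddS a_oddS !weight_even mulnS -natr1.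
by congr (_ *: _ + _ *: _); field; lra.
Qed.

Lemma mulX_evens i : 3 * 'X * evens i.+1 = 2 * odds i.+1 + odds i.
Proof.
have i0 : 0 <= i%:R :> R by [].
rewrite mulX_scale ?mulnS // /odds /scaled natl_scale !weight_odd -mulnS weight_even mulnS.
rewrite c_evenS a_evenS -natr1.
by congr (_ *: _ + _ *: _); field; lra.
Qed.

Lemma evens0 : evens 0 = 5.
Proof. by rewrite /evens /scaled weight_even P_0 mulr0 add0r scaler_nat. Qed.

Lemma odds0 : odds 0 = 6 * 'X.
Proof. by rewrite /odds /scaled weight_odd P_1 mulr0 add0r scaler_nat mulr_natl. Qed.

(** * The Chebyshev recurrence within each parity class *)

(** Applying [3x] twice gives [9x^2 f_(i+1) = 2 f_(i+2) + 5 f_(i+1) + 2 f_i] for both parities;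
    solving for [f_(i+2) + f_i] gives this factor. *)
Definition period_var : {poly R} := (2^-1)%:P * (9 * 'X ^+ 2 - 5).
Local Notation t := period_var.

Lemma half2 : (2^-1)%:P * 2 = 1 :> {poly R}.
Proof. by rewrite -(rmorph_nat polyC) -rmorphM mulVf ?rmorph1 ?pnatr_eq0. Qed.

Lemma half_cancel (p q : {poly R}) : 2 * p = 2 * q -> p = q.
Proof. by apply: mulfI; rewrite -(rmorph_nat polyC) polyC_eq0 pnatr_eq0. Qed.

Lemma period_var2 : 2 * t = 9 * 'X ^+ 2 - 5.
Proof. by rewrite /t mulrCA mulrA half2 mul1r. Qed.

Lemma evens_rec i : t * evens i.+1 = evens i.+2 + evens i.
Proof.
apply: half_cancel; rewrite mulrA period_var2.
have -> : (9 * 'X ^+ 2 - 5) * evens i.+1 =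
  3 * 'X * (3 * 'X * evens i.+1) - 5 * evens i.+1 by ring.
by rewrite mulX_evens mulrDr mulrCA !mulX_odds; ring.
Qed.

Lemma odds_rec i : t * odds i.+1 = odds i.+2 + odds i.
Proof.
apply: half_cancel; rewrite mulrA period_var2.
have -> : (9 * 'X ^+ 2 - 5) * odds i.+1 =
  3 * 'X * (3 * 'X * odds i.+1) - 5 * odds i.+1 by ring.
by rewrite mulX_odds mulrDr mulrCA !mulX_evens; ring.
Qed.

Lemma evens1 : evens 1 = 4 * t.
Proof.
have := mulX_odds 0; rewrite evens0 odds0 => /(canLR (addrK _))<-.
have -> : 4 * t = 2 * (2 * t) by ring.
by rewrite period_var2; ring.
Qed.

Lemma odds1 : odds 1 = (2 * t - 1) * (3 * 'X).
Proof.
apply: half_cancel; have := mulX_evens 0; rewrite odds0 evens1.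
by move=> /(canLR (addrK _))<-; ring.
Qed.

(** * Product formulas by parity *)

(** Keeping [e] general covers even times even and even times odd at once. The first factor starts
    at [evens 1 = 4 * t], since the constant [evens 0 = 5] does not fit the pattern. *)
Lemma evens_mul (e : nat -> {poly R}) :
  (forall i, t * e i.+1 = e i.+2 + e i) ->
  forall n d, evens n.+1 * e (d + n).+1 =
    4 * e (d + 2 + 2 * n)%N + 3 * \sum_(0 <= j < n) e (d + 2 + 2 * j)%N
    + 4 * e d.
Proof.
move=> e_rec n d.
apply: (product_formula _ t 4 3 4 (fun i => evens i.+1) (fun i => e i.+1) e).
- by move=> i; rewrite evens_rec.
- by move=> i; rewrite e_rec.
- by move=> i; rewrite evens1 -mulrA e_rec !addn2; ring.
(* Here [evens 2 = 4 * t^2 - 5]; the middle coefficient is [3 = 8 - 5]. *)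
- move=> i; have := evens_rec 0; rewrite evens0 evens1.
  move=> /(canLR (addrK _))<-; rewrite !addnS !addn0.
  have -> : e i.+4 = t * e i.+3 - e i.+2 by rewrite e_rec addrK.
  have -> : e i.+3 = t * e i.+2 - e i.+1 by rewrite e_rec addrK.
  have -> : e i = t * e i.+1 - e i.+2 by rewrite e_rec addrAC subrr add0r.
  ring.
Qed.

(** The case where the even index is the larger one; the opposite order is an instance of
    [evens_mul]. *)
Lemma odds_mul_evens n d : odds n * evens (d + n).+1 =
  4 * odds (d + 1 + 2 * n)%N + 3 * \sum_(0 <= j < n) odds (d + 1 + 2 * j)%N
  + 2 * odds d.
Proof.
apply: (product_formula _ t 4 3 2 odds (fun i => evens i.+1) odds) n d.
- exact: odds_rec.
- by move=> i; rewrite evens_rec.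
- move=> i; rewrite odds0 addn1.
  have -> : 6 * 'X * evens i.+1 = 2 * (3 * 'X * evens i.+1) by ring.
  by rewrite mulX_evens; ring.
- move=> i; rewrite odds1 -mulrA mulX_evens !addnS !addn0.
  have -> : odds i.+3 = t * odds i.+2 - odds i.+1 by rewrite odds_rec addrK.
  have -> : odds i.+2 = t * odds i.+1 - odds i by rewrite odds_rec addrK.
  ring.
Qed.

Lemma odds_mul_odds n d : odds n * odds (d + n)%N =
  2 * evens (d + 1 + 2 * n)%N + 3 * \sum_(0 <= j < n) evens (d + 2 + 2 * j)%N
  + 4 * evens d.
Proof.
apply: (product_formula _ t 2 3 4 odds odds evens) n d.
- exact: odds_rec.
- exact: odds_rec.
- move=> i; rewrite odds0 addn1.
  have -> : 6 * 'X * odds i = 2 * (3 * 'X * odds i) by ring.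
  by rewrite mulX_odds; ring.
- move=> i; rewrite odds1 -mulrA mulX_odds !addnS !addn0.
  have -> : evens i.+3 = t * evens i.+2 - evens i.+1 by rewrite evens_rec addrK.
  have -> : evens i.+2 = t * evens i.+1 - evens i by rewrite evens_rec addrK.
  ring.
Qed.

(** * Nonnegativity and support of the linearization coefficients *)

Lemma weight_gt0 n : 0 < weight n.
Proof. by rewrite ltr0n; lia. Qed.

Lemma nonneg_span_scaled lo hi k :
  (lo <= k <= hi)%N -> @nonneg_span R P lo hi (scaled k).
Proof.
by move=> lek; apply/nonneg_spanZ/nonneg_span_basis; rewrite ?ltW ?weight_gt0.
Qed.

Lemma nonneg_span_natl lo hi (k : nat) p :
  @nonneg_span R P lo hi p -> @nonneg_span R P lo hi (k%:R * p).
Proof. by rewrite natl_scale1; apply: nonneg_spanZ. Qed.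

(** The term of index [m - n] is split off to record that its coefficient is positive; all other
    terms lie strictly above it. *)
Lemma scaled_mul_span m n : (0 < n <= m)%N -> exists b : R,
  [/\ 0 < b, m = n -> b = 4
    & @nonneg_span R P (m - n).+1 (m + n)
        (scaled m * scaled n - b *: scaled (m - n))].
Proof.
have span_formula lo hi (x y z l N : nat) (F : nat -> nat) p :
    (lo < x <= hi)%N -> (forall j, (j < N)%N -> (lo < F j <= hi)%N) -> l = lo ->
    p = y%:R * scaled x + 3 * \sum_(0 <= j < N) scaled (F j) + z%:R * scaled l ->
    @nonneg_span R P lo.+1 hi (p - z%:R *: scaled lo).
  move=> ltx ltF -> ->; rewrite (natl_scale1 z) addrK.
  apply: nonneg_spanD; apply: nonneg_span_natl; first exact: nonneg_span_scaled.
  by apply: nonneg_span_sum => j jN; apply/nonneg_span_scaled/ltF.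
move=> /andP[n_gt0 lenm]; have := odd_double_half n; have := odd_double_half m.
rewrite -!mul2n; case: (odd n); case: (odd m); rewrite ?add0n ?add1n.
- set i := m./2; set j := n./2 => mE nE; exists 4; split=> //.
  apply: span_formula (etrans _ (odds_mul_odds j (i - j))); try lia.
  by rewrite mulrC; congr (scaled _ * scaled _); lia.
(* The coefficient 2 arises only for [m] even and [n] odd, which excludes [m = n]. *)
- set i := m./2; set j := n./2 => mE nE; exists 2; split=> //; first by lia.
  apply: span_formula (etrans _ (odds_mul_evens j (i - j.+1))); try lia.
  by rewrite mulrC; congr (scaled _ * scaled _); lia.
(* The predecessor of [j] undoes the shift in [evens_mul]; [j] is positive because [n] is even and
   nonzero. *)
- set i := m./2; set j := n./2 => mE nE; exists 4; split=> //.
  apply: span_formula (etrans _ (evens_mul odds odds_rec j.-1 (i - j))); try lia.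
  by rewrite mulrC; congr (scaled _ * scaled _); lia.
- set i := m./2; set j := n./2 => mE nE; exists 4; split=> //.
  apply: span_formula (etrans _ (evens_mul evens evens_rec j.-1 (i - j))); try lia.
  by rewrite mulrC; congr (scaled _ * scaled _); lia.
Qed.

Let size_P := recurrence_size a_neq0 P_0 P_1 P_rec.

Lemma mul_span m n : (0 < n <= m)%N -> exists b : R,
  [/\ 0 < b, m = n -> b = 20 / weight n ^+ 2
    & @nonneg_span R P (m - n).+1 (m + n) (P m * P n - b *: P (m - n)%N)].
Proof.
move=> nm; have [b [b0 bE sb]] := scaled_mul_span m n nm.
have w0 k : weight k != 0 by rewrite gt_eqF ?weight_gt0.
exists (b * weight (m - n) / (weight m * weight n)); split.
- by rewrite divr_gt0 ?mulr_gt0 ?weight_gt0.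
(* The constant is [20 = 4 * weight 0]. *)
- move=> mn; rewrite bE // mn subnn -(muln0 2) weight_even mulr0 add0r.
  by move: (weight n) (w0 n) => w wn0; field.
have -> : P m * P n - (b * weight (m - n) / (weight m * weight n)) *: P (m - n)%N
    = (weight m * weight n)^-1 *: (scaled m * scaled n - b *: scaled (m - n)).
  rewrite /scaled -scalerAl -scalerAr scalerBr !scalerA -[P m * P n in LHS]scale1r.
  move: (weight m) (weight n) (w0 m) (w0 n) => wm wn wm0 wn0.
  congr (_ *: _ - _ *: _); last by rewrite mulrC.
  by field; rewrite wn0.
by apply: nonneg_spanZ => //; rewrite invr_ge0 mulr_ge0 ?ltW ?weight_gt0.
Qed.

(** With truncated subtraction, [m - n + (n - m)] is [|m - n|], symmetric as the reduction to
    [n <= m] requires. For [n > 0] the remainder after splitting off [P (m - n)] has no [P 0] term,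
    so [d 0] is nonzero exactly when [m = n]. *)
Lemma mul_expansion m n : exists d : nat -> R,
  [/\ forall k, 0 <= d k,
    forall k, ~~ (m - n + (n - m) <= k <= m + n)%N -> d k = 0,
    (d 0%N != 0) = (m == n),
    m = n -> (0 < n)%N -> d 0%N = 20 / weight n ^+ 2
  & P m * P n = \sum_(0 <= k < (m + n).+1) d k *: P k].
Proof.
wlog nm : m n / (n <= m)%N => [H|].
  case: (leqP n m) => [|/ltnW] nm; first exact: H.
  have [d [d0 dz du dE dP]] := H _ _ nm; exists d.
  rewrite [P m * _]mulrC [(m + n)%N]addnC [(m - n + _)%N]addnC [m == n]eq_sym.
  by split=> // mn; move: dE; rewrite mn; apply.
case: (posnP n) => [->|n0].
  exists (fun k => 1 *+ (k == m)); split=> //.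
  - by move=> k; case: eqP => // ->; lia.
  - by rewrite pnatr_eq0 eqb0 negbK eq_sym.
  - by rewrite sum_delta_basis ?addn0 // scale1r P_0 mulr1.
have [|b [b0 bE [e [e0 ez eE]]]] := mul_span m n; first by rewrite n0.
exists (fun k => e k + b *+ (k == (m - n)%N)); split.
- by move=> k; rewrite addr_ge0 // mulrn_wge0 // ltW.
- by move=> k out; rewrite ez; [case: eqP; [lia|rewrite addr0] | lia].
- rewrite ez // add0r; have -> : (0 == m - n)%N = (m == n) by lia.
  by case: (m == n); rewrite ?mulr0n ?eqxx // gt_eqF.
- by move=> mn _; rewrite ez // mn subnn add0r bE.
under eq_bigr do rewrite scalerDl.
by rewrite big_split /= -eE sum_delta_basis ?subrK // ltnS; lia.
Qed.

Lemma linearization_exists : exists g, linearization_coefficients P g.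
Proof.
have [g gP] := choice (fun mn : nat * nat => mul_expansion mn.1 mn.2).
exists (fun m n => g (m, n)) => m n; have [_ gz _ _ gE] := gP (m, n).
by split=> // k mnk; apply: gz => /=; lia.
Qed.

(** * Properties of the linearization coefficients and the Haar function *)

Section Coefficients.
Context {g : nat -> nat -> nat -> R}.
Hypothesis lin_g : linearization_coefficients P g.

(** By uniqueness, any [g] agrees with the explicit expansion. *)
Lemma linearization_props m n :
  [/\ forall k, 0 <= g m n k, forall k, (k < m - n)%N -> g m n k = 0,
    (g m n 0%N != 0) = (m == n)
  & m = n -> (0 < n)%N -> g m n 0%N = 20 / weight n ^+ 2].
Proof.
have [d [d0 dz du dE dP]] := mul_expansion m n.
have gE : g m n =1 d.
  by apply: (linearization_unique size_P lin_g) => // k mnk; apply: dz; lia.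
split=> [k|k kmn||]; rewrite ?gE //; apply: dz; lia.
Qed.

Lemma haar0 : haar g 0 = 1.
Proof. by rewrite /haar (linearization0 size_P P_0 lin_g) divr1. Qed.

(** The formula fails at 0, where it would give 5/4 instead of 1. *)
Lemma haarE n : (0 < n)%N -> haar g n = weight n ^+ 2 / 20.
Proof.
move=> n0; rewrite /haar; have [_ _ _ ->] // := linearization_props n n.
by rewrite div1r invf_div.
Qed.

Lemma haar_ge1 n : 1 <= haar g n.
Proof.
case: (posnP n) => [->|n0]; first by rewrite haar0.
have w5 : 5 <= weight n by rewrite ler_nat; lia.
by rewrite haarE //; nra.
Qed.

End Coefficients.

End ProductFormulas.

Theorem theorem3p1 (R : realType) (a c : nat -> R) (P : nat -> {poly R})
    (c_odd : forall n : nat, (1 <= n)%N ->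
       c (2 * n - 1)%N = (6 * n%:R + 4) / (9 * n%:R + 9))
    (c_even : forall n : nat, (1 <= n)%N ->
       c (2 * n)%N = (n%:R + 1) / (3 * n%:R + 5))
    (a_def : forall n : nat, (1 <= n)%N -> a n = 1 - c n)
    (P_0 : P 0%N = 1)
    (P_1 : P 1%N = 'X)
    (P_rec : forall n : nat, (1 <= n)%N ->
       'X * P n = a n *: P n.+1 + c n *: P n.-1) :
  (exists g : nat -> nat -> nat -> R, linearization_coefficients P g) /\
  (forall g : nat -> nat -> nat -> R, linearization_coefficients P g ->
     nonnegative_linearization g /\
     induces_polynomial_hypergroup g /\
     (forall n : nat, 1 <= haar g n) /\
     (forall n : nat, (1 <= n)%N ->
        haar g (2 * n - 1)%N = 9 / 5 * (n%:R / 2 + 1 / 2) ^+ 2 /\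
        haar g (2 * n)%N = 9 / 5 * (n%:R / 2 + 5 / 6) ^+ 2) /\
     haar g 1%N = 9 / 5 /\
     (9 / 5 : R) < 2).
Proof.
split; first exact: linearization_exists c_odd c_even a_def P_0 P_1 P_rec.
move=> g lin_g.
have a0 := a_neq0 c_odd c_even a_def.
have gP m n := linearization_props c_odd c_even a_def P_0 P_1 P_rec lin_g m n.
have hE := haarE c_odd c_even a_def P_0 P_1 P_rec lin_g.
have g0 : nonnegative_linearization g by move=> m n k; case: (gP m n).
have h_odd i : haar g (2 * i).+1 = (3 * i%:R + 6) ^+ 2 / 20.
  by rewrite hE // weight_odd.
split=> //; split.
  apply: (linearization_hypergroup (recurrence_size a0 P_0 P_1 P_rec)
    P_0 (recurrence_at1 a_def a0 P_0 P_1 P_rec) lin_g g0) => m n; last by case: (gP m n).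
  by move=> k; case: (gP m n) => _ gz _ _; apply: gz.
have h_ge1 := haar_ge1 c_odd c_even a_def P_0 P_1 P_rec lin_g; split=> //.
split=> [[//|i] _|]; last split; last by lra.
  (* With [n = i + 1] the weights are [3n + 5] at [2n] and [3n + 3] at [2n - 1]; taking 6 out of
     each square turns 1/20 into 9/5. *)
  split; last by rewrite hE ?weight_even //; field.
  have -> : (2 * i.+1 - 1)%N = (2 * i).+1 by lia.
  by rewrite h_odd -natr1; field.
by rewrite -[1%N]/(2 * 0).+1 h_odd; field.
Qed.
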